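(* Let $n,d,m\ge 1$ be integers, let $\phi:\mathbb{R}^d\to\mathbb{R}^m$ be differentiable (a local operator) and let $\rho:\mathbb{R}^m\to\mathbb{R}^d$ be twice continuously differentiable (a pooling operator). Define $\gamma:(\mathbb{R}^d)^n\to\mathbb{R}^d$ by $\gamma(x_1,\dots,x_n)=\rho\left(\sum_{k=1}^n\phi(x_k)\right)$, and suppose $\gamma$ is twice continuously differentiable. Then for all $i\neq j$ in $\{1,\dots,n\}$ and every $\ell\in\{1,\dots,d\}$, $$\mathsf{mix}_{i,j}^{(\ell)}\;\le\;\left\lVert J_\phi(x_i)\right\rVert_2\cdot\left\lVert H_{\rho^{(\ell)}}\left(\sum_{k=1}^n\phi(x_k)\right)\right\rVert_2\cdot\left\lVert J_\phi(x_j)\right\rVert_2 .$$ In particular, for typical choices of $\phi$ and $\rho$ (as specified in the context), it follows that $$\mathsf{mix}_{i,j}^{(\ell)}\in\mathcal{O}\left(\lVert\theta\rVert_2^2\right),$$ where $\theta$ is the concatenation of the parameters in $\phi$ and $\rho$.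
   Context: For a twice continuously differentiable $\gamma:\mathbb{R}^{n\times d}\to\mathbb{R}^d$, viewed as a function of $n$ vectors $x_1,\dots,x_n\in\mathbb{R}^d$, with $\ell$-th output coordinate $\gamma^{(\ell)}$, the neighbor mixing of the $\ell$-th output with respect to the pair $(i,j)$ at the point $(x_1,\dots,x_n)$ is $$\mathsf{mix}_{i,j}^{(\ell)}:=\left\lVert\frac{\partial^2}{\partial x_i\,\partial x_j}\gamma^{(\ell)}(x_1,\dots,x_n)\right\rVert_2,$$ where $\frac{\partial^2}{\partial x_i\partial x_j}\gamma^{(\ell)}$ is the $d\times d$ matrix of mixed second partial derivatives of $\gamma^{(\ell)}$ with respect to the coordinates of $x_i$ and those of $x_j$, and $\lVert\cdot\rVert_2$ is the spectral (operator) norm for matrices and the Euclidean norm for vectors. $J_\phi(x)$ is the ($m\times d$) Jacobian matrix of $\phi$ at $x$, $\rho^{(\ell)}$ is the $\ell$-th coordinate of $\rho$, and $H_{\rho^{(\ell)}}(z)$ is the ($m\times m$) Hessian matrix of $\rho^{(\ell)}$ at $z$. ''Typical choices'' of $\phi$ and $\rho$ means: $\phi(x)=\sigma(Ax+b)$ and $\rho(z)=W_2\,\sigma(W_1z+\beta_1)+\beta_2$, with learnable parameters $A\in\mathbb{R}^{m\times d}$, $b\in\mathbb{R}^m$, $W_1\in\mathbb{R}^{m\times m}$, $\beta_1\in\mathbb{R}^m$, $W_2\in\mathbb{R}^{d\times m}$, $\beta_2\in\mathbb{R}^d$ (so $\theta$ is the concatenation of all of these), where $\sigma$ is an activation function applied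 element-wise with $|\sigma'|\le c_1$ and $|\sigma''|\le c_2$ for constants $c_1,c_2$.
   Formalization: The O(‖θ‖²) claim fails for unrestricted θ (σ=sin, A=W1=W2=t gives mix=t⁵); it is proved as θ→0, and with a uniform constant depending on B for all θ with ‖W1‖₂,‖W2‖₂ ≤ B. *)

(* Defs.v *)
From HB Require Import structures.
From mathcomp Require Import all_boot all_order all_algebra.
From mathcomp Require Import all_classical all_reals all_analysis.

Set Implicit Arguments.
Unset Strict Implicit.
Unset Printing Implicit Defensive.

Import Order.TTheory GRing.Theory Num.Theory.
Import numFieldNormedType.Exports.

Local Open Scope classical_set_scope.
Local Open Scope ring_scope.

(* Vectors of R^k are row vectors 'rV[R]_k, and a point (x_1, ..., x_n) of
   (R^d)^n is the n x d matrix whose k-th row is x_k.  The topology on matrices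
   is the library's; the norms of the statement are the two defined here. *)

Section Norms.
Variable R : realType.

(* Euclidean norm of the family of entries; used on row and column vectors. *)
Definition norm2 m n (v : 'M[R]_(m, n)) : R :=
  Num.sqrt (\sum_i \sum_j v i j ^+ 2).

Definition spectral_norm m n (M : 'M[R]_(m, n)) : R :=
  sup [set norm2 (M *m v) | v in [set v : 'cV[R]_n | norm2 v <= 1]].

End Norms.

Section Derivatives.
Variable R : realType.

(* Over a finite-dimensional V, continuity of the differential amounts to
   continuity of every directional derivative. *)
Definition C1 (V W : normedModType R) (f : V -> W) : Prop :=
  (forall x, differentiable f x) /\ (forall v, continuous ('D_v f)).

Definition C2 (V W : normedModType R) (f : V -> W) : Prop :=
  C1 f /\ (forall v, C1 ('D_v f)).

Definition output (T : Type) k (f : T -> 'rV[R]_k) (l : 'I_k) : T -> R :=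
  fun x => f x ord0 l.

(* The library's ['J f x] acts on row vectors on the right, so it is the
   transpose of the usual matrix of partial derivatives. *)
Definition Jmx d m (f : 'rV[R]_d -> 'rV[R]_m) (x : 'rV[R]_d) : 'M[R]_(m, d) :=
  ('J f x)^T.

Definition hessian m (f : 'rV[R]_m -> R) (z : 'rV[R]_m) : 'M[R]_m :=
  \matrix_(p, q) 'D_(delta_mx ord0 p) ('D_(delta_mx ord0 q) f) z.

(* d^2 f / dx_i dx_j: the variable x_i has coordinates X i 0, ..., X i (d-1). *)
Definition mixed_hessian n d (f : 'M[R]_(n, d) -> R) (i j : 'I_n)
    (X : 'M[R]_(n, d)) : 'M[R]_d :=
  \matrix_(a, b) 'D_(delta_mx i a) ('D_(delta_mx j b) f) X.

Definition mix n d (g : 'M[R]_(n, d) -> 'rV[R]_d) (i j : 'I_n) (l : 'I_d)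
    (X : 'M[R]_(n, d)) : R :=
  spectral_norm (mixed_hessian (output g l) i j X).

End Derivatives.

Section Aggregation.
Variable R : realType.

Definition pooled n d m (phi : 'rV[R]_d -> 'rV[R]_m) (X : 'M[R]_(n, d)) :
    'rV[R]_m :=
  \sum_(k < n) phi (row k X).

Definition aggregate n d m (phi : 'rV[R]_d -> 'rV[R]_m)
    (rho : 'rV[R]_m -> 'rV[R]_d) (X : 'M[R]_(n, d)) : 'rV[R]_d :=
  rho (pooled phi X).

End Aggregation.

Section TypicalChoices.
Variable R : realType.
Variables d m : nat.

Definition dense_local (sigma : R -> R) (A : 'M[R]_(m, d)) (b : 'rV[R]_m)
    (x : 'rV[R]_d) : 'rV[R]_m :=
  map_mx sigma (x *m A^T + b).

Definition mlp_pool (sigma : R -> R) (W1 : 'M[R]_m) (beta1 : 'rV[R]_m)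
    (W2 : 'M[R]_(d, m)) (beta2 : 'rV[R]_d) (z : 'rV[R]_m) : 'rV[R]_d :=
  map_mx sigma (z *m W1^T + beta1) *m W2^T + beta2.

(* theta = (A, b, W1, beta1, W2, beta2), matrices being flattened by [mxvec]. *)
Definition nparams : nat := m * d + (m + (m * m + (m + (d * m + d)))).

Implicit Type theta : 'rV[R]_nparams.

Definition par_A theta : 'M[R]_(m, d) := vec_mx (lsubmx theta).
Definition par_b theta : 'rV[R]_m := lsubmx (rsubmx theta).
Definition par_W1 theta : 'M[R]_m := vec_mx (lsubmx (rsubmx (rsubmx theta))).
Definition par_beta1 theta : 'rV[R]_m :=
  lsubmx (rsubmx (rsubmx (rsubmx theta))).
Definition par_W2 theta : 'M[R]_(d, m) :=
  vec_mx (lsubmx (rsubmx (rsubmx (rsubmx (rsubmx theta))))).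
Definition par_beta2 theta : 'rV[R]_d :=
  rsubmx (rsubmx (rsubmx (rsubmx (rsubmx theta)))).

Definition typical_local (sigma : R -> R) theta : 'rV[R]_d -> 'rV[R]_m :=
  dense_local sigma (par_A theta) (par_b theta).

Definition typical_pool (sigma : R -> R) theta : 'rV[R]_m -> 'rV[R]_d :=
  mlp_pool sigma (par_W1 theta) (par_beta1 theta)
                 (par_W2 theta) (par_beta2 theta).

Definition typical_aggregate n (sigma : R -> R) theta :
    'M[R]_(n, d) -> 'rV[R]_d :=
  aggregate (typical_local sigma theta) (typical_pool sigma theta).

End TypicalChoices.

Arguments typical_aggregate {R d m n} sigma theta _.
Arguments par_W1 {R d m} theta.
Arguments par_W2 {R d m} theta.

(* Main.v *)
From HB Require Import structures.
Require Import Defs.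
From mathcomp Require Import all_boot all_order all_algebra.
From mathcomp Require Import all_classical all_reals all_analysis.
From mathcomp Require Import ring.
Import Order.TTheory GRing.Theory Num.Theory.
Import numFieldNormedType.Exports.
Local Open Scope classical_set_scope.
Local Open Scope ring_scope.

Set Implicit Arguments.
Unset Strict Implicit.

(* Since [i != j], differentiating in the direction of [x_i] leaves the Jacobian
   of [phi] at [x_j] unchanged, so the chain rule gives
   [d^2 gamma_l / dx_i dx_j = J_phi(x_i)^T H J_phi(x_j)], and the bound is
   submultiplicativity of the spectral norm and its invariance under transpose.
   For the typical choices [J_phi = diag(sigma') A] and
   [H = W1^T diag(W2_l sigma'') W1], whence
   [mix <= c1^2 c2 |W1|^2 |W2| |A|^2]: quadratic in [theta] once [W1] and [W2]
   are bounded. *)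

(** * Euclidean and spectral norms of matrices *)

Section MatrixNorms.
Context {R : realType}.

(** Lagrange's identity: the double sum of the squares of [a i * b j - a j * b i] is twice the gap
    between the two sides. *)
Lemma sum_cauchy_schwarz (I : finType) (a b : I -> R) :
  (\sum_i a i * b i) ^+ 2 <= (\sum_i a i ^+ 2) * (\sum_i b i ^+ 2).
Proof.
have : 0 <= \sum_i \sum_j (a i * b j - a j * b i) ^+ 2.
  by apply: sumr_ge0 => i _; apply: sumr_ge0 => j _; exact: sqr_ge0.
suff -> : \sum_i \sum_j (a i * b j - a j * b i) ^+ 2 =
    ((\sum_i a i ^+ 2) * (\sum_i b i ^+ 2) - (\sum_i a i * b i) ^+ 2) *+ 2.
  by rewrite pmulrn_lge0 // subr_ge0.
rewrite expr2 !big_distrlr mulr2n /=.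
rewrite [X in _ = _ + (X - _)]exchange_big /= -!sumrB -big_split /=.
apply: eq_bigr => i _; rewrite -!sumrB -big_split /=.
by apply: eq_bigr => j _; ring.
Qed.

Lemma norm2_ge0 m n (v : 'M[R]_(m, n)) : 0 <= norm2 v.
Proof. exact: sqrtr_ge0. Qed.

Lemma norm2_sqr m n (v : 'M[R]_(m, n)) :
  norm2 v ^+ 2 = \sum_i \sum_j v i j ^+ 2.
Proof.
by rewrite sqr_sqrtr //; do 2![apply: sumr_ge0 => ? _]; exact: sqr_ge0.
Qed.

Lemma norm2_le m n p q (u : 'M[R]_(m, n)) (v : 'M[R]_(p, q)) :
  norm2 u ^+ 2 <= norm2 v ^+ 2 -> norm2 u <= norm2 v.
Proof. by rewrite ler_pXn2r // nnegrE norm2_ge0. Qed.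

Lemma norm2Z m n (k : R) (v : 'M[R]_(m, n)) : norm2 (k *: v) = `|k| * norm2 v.
Proof.
rewrite /norm2 -[`|k|]sqrtr_sqr -sqrtrM ?sqr_ge0 //.
rewrite mulr_sumr; congr Num.sqrt; apply: eq_bigr => i _.
by rewrite mulr_sumr; apply: eq_bigr => j _; rewrite mxE exprMn.
Qed.

Lemma norm2_0 m n : norm2 (0 : 'M[R]_(m, n)) = 0.
Proof. by rewrite -(scale0r 0) norm2Z normr0 mul0r. Qed.

Lemma norm2_eq0 m n (v : 'M[R]_(m, n)) : norm2 v = 0 -> v = 0.
Proof.
move=> v0; have := norm2_sqr v; rewrite v0 expr0n /= => /esym /eqP.
rewrite psumr_eq0 => [/allP /= h|i _]; last first.
  by apply: sumr_ge0 => j _; exact: sqr_ge0.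
apply/matrixP => i j; have := h i (mem_index_enum _).
rewrite psumr_eq0 => [/allP /= h'|k _]; last exact: sqr_ge0.
by have := h' j (mem_index_enum _); rewrite sqrf_eq0 mxE => /eqP.
Qed.

Lemma norm2_delta n (i : 'I_n) : norm2 (delta_mx i 0 : 'cV[R]_n) = 1.
Proof.
rewrite /norm2 (bigD1 i) //= big_ord1 mxE !eqxx /= big1 => [|k ki].
  by rewrite expr1n addr0 sqrtr1.
by rewrite big_ord1 mxE (negbTE ki) expr0n.
Qed.

Lemma ler_entry_norm2 m n (v : 'M[R]_(m, n)) i j : `|v i j| <= norm2 v.
Proof.
rewrite -(ler_pXn2r (ltn0Sn 1)) ?nnegrE ?norm2_ge0 //.
rewrite norm2_sqr real_normK ?num_real // (bigD1 i) //= (bigD1 j) //=.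
rewrite -addrA lerDl addr_ge0 //.
  by apply: sumr_ge0 => k _; exact: sqr_ge0.
by do 2![apply: sumr_ge0 => ? _]; exact: sqr_ge0.
Qed.

(** On matrices [norm2] is the Frobenius norm, and Cauchy-Schwarz applies to each entry of the
    product. With [N] a vector of norm at most 1, this shows that the set defining [spectral_norm M]
    is bounded. *)
Lemma norm2_mulmx_le m n p (M : 'M[R]_(m, n)) (N : 'M[R]_(n, p)) :
  norm2 (M *m N) <= norm2 M * norm2 N.
Proof.
rewrite -(ler_pXn2r (ltn0Sn 1)) ?nnegrE ?mulr_ge0 ?norm2_ge0 //.
rewrite exprMn !norm2_sqr [X in _ <= _ * X]exchange_big /= big_distrlr /=.
apply: ler_sum => i _; apply: ler_sum => j _; rewrite mxE.
exact: sum_cauchy_schwarz.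
Qed.

(** Rescaling a nonzero [v] to length 1 puts it among the vectors over which the supremum is taken;
    [norm2 M] bounds that set, so [sup] is a true upper bound. *)
Lemma norm2_mulmx_le_spectral m n (M : 'M[R]_(m, n)) (v : 'cV[R]_n) :
  norm2 (M *m v) <= spectral_norm M * norm2 v.
Proof.
have [/norm2_eq0 ->|v0] := eqVneq (norm2 v) 0.
  by rewrite mulmx0 !norm2_0 mulr0.
have v_gt0 : 0 < norm2 v by rewrite lt_neqAle eq_sym v0 norm2_ge0.
rewrite -ler_pdivrMr // mulrC -[(norm2 v)^-1]gtr0_norm ?invr_gt0 //.
rewrite -norm2Z scalemxAr; apply: ub_le_sup => /=.
  exists (norm2 M) => _ [w /= w1 <-]; apply: le_trans (norm2_mulmx_le _ _) _.
  by rewrite ler_piMr ?norm2_ge0.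
exists ((norm2 v)^-1 *: v) => //=.
by rewrite norm2Z gtr0_norm ?invr_gt0 // mulVf.
Qed.

Lemma spectral_norm_le m n (M : 'M[R]_(m, n)) (c : R) : 0 <= c ->
  (forall v : 'cV[R]_n, norm2 (M *m v) <= c * norm2 v) -> spectral_norm M <= c.
Proof.
move=> c0 Mc; apply: ge_sup.
  (* The zero vector shows that the set is nonempty, even when [n] is 0. *)
  by exists (norm2 (M *m (0 : 'cV[R]_n))); exists 0 => //=; rewrite norm2_0.
by move=> _ [w /= w1 <-]; apply: le_trans (Mc w) _; rewrite ler_piMr.
Qed.

Lemma spectral_norm_ge0 m n (M : 'M[R]_(m, n)) : 0 <= spectral_norm M.
Proof.
apply: ub_le_sup => /=; last by exists 0 => /=; rewrite ?mulmx0 norm2_0.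
exists (norm2 M) => _ [w /= w1 <-]; apply: le_trans (norm2_mulmx_le _ _) _.
by rewrite ler_piMr ?norm2_ge0.
Qed.

Lemma spectral_norm_le_norm2 m n (M : 'M[R]_(m, n)) :
  spectral_norm M <= norm2 M.
Proof.
by apply: spectral_norm_le => [|v]; [exact: norm2_ge0|exact: norm2_mulmx_le].
Qed.

Lemma spectral_normM m n p (M : 'M[R]_(m, n)) (N : 'M[R]_(n, p)) :
  spectral_norm (M *m N) <= spectral_norm M * spectral_norm N.
Proof.
apply: spectral_norm_le => [|v]; first by rewrite mulr_ge0 ?spectral_norm_ge0.
rewrite -mulmxA -mulrA; apply: le_trans (norm2_mulmx_le_spectral _ _) _.
by rewrite ler_wpM2l ?spectral_norm_ge0 ?norm2_mulmx_le_spectral.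
Qed.

Lemma ler_entry_spectral_norm m n (M : 'M[R]_(m, n)) i j :
  `|M i j| <= spectral_norm M.
Proof.
have := norm2_mulmx_le_spectral M (delta_mx j 0); rewrite norm2_delta mulr1.
apply: le_trans; rewrite -colE.
by have := ler_entry_norm2 (col j M) i 0; rewrite mxE.
Qed.

Lemma norm2_tr m n (M : 'M[R]_(m, n)) : norm2 M^T = norm2 M.
Proof.
rewrite /norm2 exchange_big; congr Num.sqrt.
by apply: eq_bigr => i _; apply: eq_bigr => j _; rewrite mxE.
Qed.

Lemma norm2_cV_sqr n (v : 'cV[R]_n) : norm2 v ^+ 2 = (v^T *m v) 0 0.
Proof.
by rewrite norm2_sqr mxE; apply: eq_bigr => i _; rewrite big_ord1 mxE expr2.
Qed.

(** With [w = M^T *m v], the square of [norm2 w] is the scalar [v^T *m (M *m w)], at most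
    [norm2 v * (spectral_norm M * norm2 w)]; then divide by [norm2 w]. *)
Lemma spectral_norm_tr_le m n (M : 'M[R]_(m, n)) :
  spectral_norm M^T <= spectral_norm M.
Proof.
apply: spectral_norm_le => [|v]; first exact: spectral_norm_ge0.
have [->|w0] := eqVneq (norm2 (M^T *m v)) 0.
  by rewrite mulr_ge0 ?spectral_norm_ge0 ?norm2_ge0.
have w_gt0 : 0 < norm2 (M^T *m v) by rewrite lt_neqAle eq_sym w0 norm2_ge0.
rewrite -(ler_pM2r w_gt0) -expr2 norm2_cV_sqr trmx_mul trmxK -mulmxA.
apply: le_trans (ler_norm _) _; apply: le_trans (ler_entry_norm2 _ _ _) _.
apply: le_trans (norm2_mulmx_le _ _) _.
rewrite norm2_tr mulrAC mulrC ler_wpM2r ?norm2_ge0 //.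
exact: norm2_mulmx_le_spectral.
Qed.

Lemma spectral_norm_diag_le n (v : 'rV[R]_n) (c : R) : 0 <= c ->
  (forall k, `|v 0 k| <= c) -> spectral_norm (diag_mx v) <= c.
Proof.
move=> c0 vc; apply: spectral_norm_le => // w.
rewrite -[c in c * _]ger0_norm // -norm2Z; apply: norm2_le; rewrite !norm2_sqr.
apply: ler_sum => i _; apply: ler_sum => j _.
rewrite mul_diag_mx !mxE !exprMn ler_wpM2r ?sqr_ge0 //.
by rewrite -[v 0 i ^+ 2]real_normK ?num_real // lerXn2r ?nnegrE.
Qed.

Lemma norm2_row_mx_sqr m n p (u : 'M[R]_(m, n)) (v : 'M[R]_(m, p)) :
  norm2 (row_mx u v) ^+ 2 = norm2 u ^+ 2 + norm2 v ^+ 2.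
Proof.
rewrite !norm2_sqr -big_split /=; apply: eq_bigr => i _.
rewrite big_split_ord /=.
by congr (_ + _); apply: eq_bigr => j _; rewrite ?row_mxEl ?row_mxEr.
Qed.

Lemma norm2_lsubmx_le m n p (v : 'M[R]_(m, n + p)) :
  norm2 (lsubmx v) <= norm2 v.
Proof.
by apply: norm2_le; rewrite -{2}[v]hsubmxK norm2_row_mx_sqr lerDl sqr_ge0.
Qed.

Lemma norm2_rsubmx_le m n p (v : 'M[R]_(m, n + p)) :
  norm2 (rsubmx v) <= norm2 v.
Proof.
by apply: norm2_le; rewrite -{2}[v]hsubmxK norm2_row_mx_sqr lerDr sqr_ge0.
Qed.

Lemma norm2_vec_mx m n (v : 'rV[R]_(m * n)) : norm2 (vec_mx v) = norm2 v.
Proof.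
rewrite /norm2 big_ord1 pair_big /=; congr Num.sqrt.
rewrite [RHS](reindex (uncurry (@mxvec_index m n))) /=; last first.
  exact: curry_mxvec_bij.
by apply: eq_bigr => -[i j] _; rewrite mxE.
Qed.

End MatrixNorms.

(** * Differentials on matrix spaces and the mixed Hessian of a pooled function *)

Section MatrixCalculus.
Context {R : realType}.

Lemma is_diffE (V W : normedModType R) (f df : V -> W) x v :
  is_diff x f df -> 'd f x v = df v.
Proof. by move=> fx; rewrite diff_val. Qed.

(** In finite dimension a linear map is a finite sum of coordinate functions times fixed vectors
    [f (delta_mx i j)], and coordinates are differentiable. *)
Lemma linear_mx_continuous m n (W : normedModType R)
    (f : {linear 'M[R]_(m, n) -> W}) : continuous f.
Proof.
have -> : (f : _ -> _) =
    \sum_(i < m) \sum_(j < n)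
      (fun M : 'M[R]_(m, n) => M i j *: f (delta_mx i j)).
  apply/funext => M; rewrite fct_sumE {1}[M]matrix_sum_delta linear_sum.
  apply: eq_bigr => i _; rewrite fct_sumE linear_sum.
  by apply: eq_bigr => j _; rewrite linearZ.
move=> M; apply: (@differentiable_continuous R).
apply: differentiable_sum => i; apply: differentiable_sum => j.
exact/differentiableZl/differentiable_coord.
Qed.

Lemma linear_mx_is_diff m n (W : normedModType R)
    (f : {linear 'M[R]_(m, n) -> W}) X : is_diff X f f.
Proof.
have cf : continuous f by exact: linear_mx_continuous.
by apply: DiffDef; [exact: linear_differentiable|exact: diff_lin].
Qed.

Lemma is_diff_coord m n (M : 'M[R]_(m, n)) i j :
  is_diff M (fun N : 'M[R]_(m, n) => N i j) (fun N : 'M[R]_(m, n) => N i j).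
Proof.
have lf : linear (fun N : 'M[R]_(m, n) => N i j) by move=> ? ? ?; rewrite !mxE.
(* Packing the coordinate function as a linear map makes it its own differential. *)
pose g : {linear _ -> _} := HB.pack (fun N : 'M[R]_(m, n) => N i j)
  (GRing.isLinear.Build _ _ _ _ _ lf).
exact: (linear_mx_is_diff g).
Qed.

Lemma is_diff_output (V : normedModType R) k (f df : V -> 'rV[R]_k) x l :
  is_diff x f df -> is_diff x (output f l) (output df l).
Proof.
move=> fx; exact: (is_diff_comp fx (is_diff_coord (f x) ord0 l)).
Qed.

(** Differentiability comes from expanding [f] in the standard basis; the differential is then
    identified one output at a time. *)
Lemma is_diff_rV (V : normedModType R) k (f df : V -> 'rV[R]_k) x :
  (forall l, is_diff x (output f l) (output df l)) -> is_diff x f df.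
Proof.
move=> fx; have dfx : differentiable f x.
  have -> : f = \sum_l (fun y => output f l y *: delta_mx ord0 l).
    apply/funext => y; rewrite fct_sumE; apply/rowP => j.
    rewrite summxE (bigD1 j) //= !mxE !eqxx mulr1 big1 ?addr0 // => i ij.
    by rewrite !mxE /= eq_sym (negbTE ij) mulr0.
  by apply: differentiable_sum => l; exact: differentiableZl.
apply: DiffDef => //; apply/funext => v; apply/rowP => l.
rewrite -[RHS](is_diffE v (fx l)).
by rewrite (is_diffE v (is_diff_output l (differentiableP dfx))).
Qed.

Lemma is_diff_sum (V W : normedModType R) n (f df : 'I_n -> V -> W) x :
  (forall k, is_diff x (f k) (df k)) ->
  is_diff x (fun y => \sum_k f k y) (fun v => \sum_k df k v).
Proof.
rewrite -!fct_sumE.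
elim: n f df => [|n IH] f df fx.
  by rewrite !big_ord0; exact: is_diff_cst.
by rewrite !big_ord_recr /=; apply: is_diffD => //; apply: IH.
Qed.

Lemma is_diff_pooled n d m (phi : 'rV[R]_d -> 'rV[R]_m) (X : 'M[R]_(n, d)) :
  (forall x, differentiable phi x) ->
  is_diff X (pooled phi) (fun V => \sum_k 'd phi (row k X) (row k V)).
Proof.
move=> dphi; apply: is_diff_sum => k.
apply: (is_diff_comp (linear_mx_is_diff (row k) X)).
exact: differentiableP.
Qed.

(** The derivative ['D_v f] is linear in [v] and its differential is linear in [u], so expanding
    both in the standard basis gives a bilinear form. The outer direction [u] stands on the left, as
    the row index of [hessian] belongs to the outer derivative. *)
Lemma diff_hessian m (f : 'rV[R]_m -> R) (z u v : 'rV[R]_m) :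
  (forall y, differentiable f y) -> (forall w y, differentiable ('D_w f) y) ->
  'd ('D_v f) z u = (u *m hessian f z *m v^T) 0 0.
Proof.
move=> df d2f.
have -> : 'D_v f = \sum_q v 0 q *: 'D_(delta_mx 0 q) f.
  apply/funext => y; rewrite deriveE // {1}[v]row_sum_delta linear_sum fct_sumE.
  apply: eq_bigr => q _; rewrite linearZ -deriveE //.
rewrite -deriveE; last first.
  by apply: differentiable_sum => q; exact: differentiableZ.
rewrite derive_sum => [|q]; last first.
  by apply: diff_derivable; exact: differentiableZ.
rewrite mxE; apply: eq_bigr => q _; rewrite [v^T _ _]mxE mulrC.
rewrite deriveZ ?deriveE //; last exact: diff_derivable.
congr (_ * _); rewrite {1}[u]row_sum_delta linear_sum mxE.
by apply: eq_bigr => p _; rewrite linearZ /= !mxE deriveE.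
Qed.

(** A directional derivative sees only the values on the line through [a], the base point being the
    case [h = 0]. *)
Lemma eq_derive_line (V W : normedModType R) (f g : V -> W) (a v : V) :
  (forall h : R, f (h *: v + a) = g (h *: v + a)) -> 'D_v f a = 'D_v g a.
Proof.
move=> fg; have fga : f a = g a by have := fg 0; rewrite scale0r add0r.
by rewrite /derive; under eq_fun do rewrite /= fg fga.
Qed.

(* Along [delta_mx i a] with [i != j] the j-th row is constant, so the inner
   derivative may be replaced by [dF], in which the j-th differential of [phi]
   is frozen: no second derivative of [phi] is involved. *)
Lemma mixed_hessian_pooled n d m (phi : 'rV[R]_d -> 'rV[R]_m)
    (f : 'rV[R]_m -> R) (i j : 'I_n) (X : 'M[R]_(n, d)) :
  i != j ->
  (forall x, differentiable phi x) -> (forall z, differentiable f z) ->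
  (forall v z, differentiable ('D_v f) z) ->
  mixed_hessian (f \o pooled phi) i j X =
    (Jmx phi (row i X))^T *m hessian f (pooled phi X) *m Jmx phi (row j X).
Proof.
move=> ij dphi df d2f.
(* Moving coordinate [b] of the [k]-th point affects only the [k]-th summand, whose differential at
   the basis vector [b] is a row of ['J phi]. *)
have dpooled (Y : 'M[R]_(n, d)) k b : 'd (pooled phi) Y (delta_mx k b) =
    row b ('J phi (row k Y)).
  rewrite (is_diffE _ (is_diff_pooled Y dphi)).
  rewrite (bigD1 k) //= big1 ?addr0 => [|k' k'k]; last first.
    rewrite (_ : row k' (delta_mx k b) = 0) ?linear0 //; apply/rowP => l.
    by rewrite !mxE (negbTE k'k).
  rewrite [RHS]rowE mul_rV_lin1; congr ('d phi _ _).
  by apply/rowP => l; rewrite !mxE eqxx.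
have diff_pooled (Y : 'M[R]_(n, d)) : differentiable (pooled phi) Y.
  by have [] := is_diff_pooled Y dphi.
apply/matrixP => a b; rewrite [LHS]mxE.
pose dF : 'M[R]_(n, d) -> R :=
  'D_(row b ('J phi (row j X))) f \o pooled phi.
have -> : 'D_(delta_mx i a) ('D_(delta_mx j b) (f \o pooled phi)) X =
    'D_(delta_mx i a) dF X.
  apply: eq_derive_line => h; have hX : row j (h *: delta_mx i a + X) = row j X.
    by apply/rowP => l; rewrite !mxE eq_sym (negbTE ij) mulr0 add0r.
  rewrite /dF /= !deriveE //; last exact: differentiable_comp.
  by rewrite diff_comp //= dpooled hX.
rewrite deriveE; last exact: differentiable_comp.
rewrite diff_comp //= dpooled diff_hessian // /Jmx !trmxK.
rewrite -row_mul mxE [RHS]mxE.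
apply: eq_bigr => q _.
by rewrite [row a _ _ _]mxE [(row b _)^T _ _]mxE [row b _ _ _]mxE
  [('J phi _)^T _ _]mxE.
Qed.

End MatrixCalculus.

(** * Jacobians and Hessians of the typical local and pooling maps *)

Section TypicalDerivatives.
Context {R : realType}.
Implicit Type sigma : R -> R.

Lemma is_diff_map_mx k sigma (y : 'rV[R]_k) : (forall t, derivable sigma t 1) ->
  is_diff y (map_mx sigma : 'rV[R]_k -> 'rV[R]_k)
    (fun h => h *m diag_mx (map_mx (sigma^`())%classic y)).
Proof.
move=> ds; apply: is_diff_rV => l.
have -> : output (map_mx sigma) l = sigma \o (fun N : 'rV[R]_k => N ord0 l).
  by apply/funext => z; rewrite /output mxE.
have -> : output (fun h => h *m diag_mx (map_mx (sigma^`())%classic y)) l =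
    ( *:%R^~ ((sigma^`())%classic (y ord0 l))) \o
    (fun N : 'rV[R]_k => N ord0 l).
  by apply/funext => z; rewrite /output mul_mx_diag !mxE.
apply: is_diff_comp; first exact: is_diff_coord.
by apply: DiffDef; [exact/derivable1_diffP|exact: deriv1E].
Qed.

Lemma is_diff_affine k p (P : 'M[R]_(k, p)) (b : 'rV[R]_p) (x : 'rV[R]_k) :
  is_diff x (fun y => y *m P + b) (mulmxr P).
Proof.
rewrite -[mulmxr P : _ -> _]addr0.
exact: (is_diffD (linear_mx_is_diff (mulmxr P) x) (is_diff_cst b x)).
Qed.

(** The diagonal factor is again a dense layer, with the same weights and activation [sigma'], so
    later bounds on its entries reduce to bounds on [sigma']. *)
Lemma is_diff_dense_local k p sigma (A : 'M[R]_(p, k)) (b : 'rV[R]_p) x :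
  (forall t, derivable sigma t 1) ->
  is_diff x (dense_local sigma A b)
    (fun h => h *m A^T *m diag_mx (dense_local (sigma^`())%classic A b x)).
Proof.
move=> ds; exact: (is_diff_comp (is_diff_affine A^T b x)
  (is_diff_map_mx (x *m A^T + b) ds)).
Qed.

Lemma Jmx_dense_local k p sigma (A : 'M[R]_(p, k)) (b : 'rV[R]_p) x :
  (forall t, derivable sigma t 1) ->
  Jmx (dense_local sigma A b) x =
    diag_mx (dense_local (sigma^`())%classic A b x) *m A.
Proof.
move=> ds; rewrite -[RHS]trmxK /Jmx trmx_mul tr_diag_mx; congr (_^T).
apply/row_matrixP => i; rewrite rowE mul_rV_lin1.
by rewrite (is_diffE _ (is_diff_dense_local A b x ds)) -mulmxA rowE.
Qed.

Lemma is_diff_mlp_pool d m sigma (W1 : 'M[R]_m) (beta1 : 'rV[R]_m)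
    (W2 : 'M[R]_(d, m)) (beta2 : 'rV[R]_d) z :
  (forall t, derivable sigma t 1) ->
  is_diff z (mlp_pool sigma W1 beta1 W2 beta2)
    (fun h => h *m W1^T *m diag_mx (dense_local (sigma^`())%classic W1 beta1 z)
                *m W2^T).
Proof.
move=> ds; exact: (is_diff_comp (is_diff_dense_local W1 beta1 z ds)
  (is_diff_affine W2^T beta2 (dense_local sigma W1 beta1 z))).
Qed.

Lemma differentiable_output_mlp_pool d m sigma (W1 : 'M[R]_m) (beta1 : 'rV[R]_m)
    (W2 : 'M[R]_(d, m)) (beta2 : 'rV[R]_d) l z :
  (forall t, derivable sigma t 1) ->
  differentiable (output (mlp_pool sigma W1 beta1 W2 beta2) l) z.
Proof.
move=> ds.
by have [] := is_diff_output l (is_diff_mlp_pool W1 beta1 W2 beta2 z ds).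
Qed.

(* Differentiating a pooling network in a direction [v] gives another one,
   with activation [sigma'] and the output weights rescaled by [W1 v]. *)
Lemma derive_output_mlp_pool d m sigma (W1 : 'M[R]_m) (beta1 : 'rV[R]_m)
    (W2 : 'M[R]_(d, m)) (beta2 : 'rV[R]_d) l v :
  (forall t, derivable sigma t 1) ->
  'D_v (output (mlp_pool sigma W1 beta1 W2 beta2) l) =
  output (mlp_pool (sigma^`())%classic W1 beta1
    (W2 *m diag_mx (v *m W1^T)) 0) l.
Proof.
move=> ds; apply/funext => z.
rewrite deriveE; last exact: differentiable_output_mlp_pool.
rewrite (is_diffE _ (is_diff_output l
  (is_diff_mlp_pool W1 beta1 W2 beta2 z ds))).
rewrite /output /mlp_pool addr0 trmx_mul tr_diag_mx mulmxA.
by congr ((_ *m _) _ _); apply/rowP => k; rewrite !mul_mx_diag !mxE mulrC.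
Qed.

(** Two uses of [derive_output_mlp_pool]: each differentiation along a basis vector multiplies the
    output weights by a column of [W1], and the activation ends up as [sigma'']. *)
Lemma hessian_mlp_pool d m sigma (W1 : 'M[R]_m) (beta1 : 'rV[R]_m)
    (W2 : 'M[R]_(d, m)) (beta2 : 'rV[R]_d) l z :
  (forall t, derivable sigma t 1) ->
  (forall t, derivable (sigma^`())%classic t 1) ->
  hessian (output (mlp_pool sigma W1 beta1 W2 beta2) l) z =
    W1^T *m diag_mx (\row_k (W2 l k * (sigma^`(2))%classic
      ((z *m W1^T + beta1) 0 k))) *m W1.
Proof.
move=> ds d2s; apply/matrixP => p q; rewrite [LHS]mxE.
rewrite derive_output_mlp_pool //.
rewrite [LHS](congr1 (@^~ z) (derive_output_mlp_pool _ _ _ _ _ _ d2s)).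
rewrite /output /mlp_pool addr0 -!rowE !mxE.
apply: eq_bigr => k _; rewrite !mul_mx_diag.
rewrite !mxE (derive1nS sigma 1) derive1n1.
ring.
Qed.

End TypicalDerivatives.

(** * Bounds on the mixing, in general and for the typical choices *)

Section MixBounds.
Context {R : realType}.

(** Regularity is asked of the single output [l], without continuity of second derivatives, so that
    the lemma also covers typical networks whose [sigma''] is merely bounded. *)
Lemma mix_aggregate_le n d m (phi : 'rV[R]_d -> 'rV[R]_m)
    (rho : 'rV[R]_m -> 'rV[R]_d) (X : 'M[R]_(n, d)) (i j : 'I_n) (l : 'I_d) :
  i != j -> (forall x, differentiable phi x) ->
  (forall z, differentiable (output rho l) z) ->
  (forall v z, differentiable ('D_v (output rho l)) z) ->
  mix (aggregate phi rho) i j l X <=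
    spectral_norm (Jmx phi (row i X)) *
    spectral_norm (hessian (output rho l) (pooled phi X)) *
    spectral_norm (Jmx phi (row j X)).
Proof.
move=> ij dphi drho d2rho; rewrite /mix.
have -> : output (aggregate phi rho) l = output rho l \o pooled phi by [].
rewrite mixed_hessian_pooled //; apply: le_trans (spectral_normM _ _) _.
rewrite ler_wpM2r ?spectral_norm_ge0 //.
apply: le_trans (spectral_normM _ _) _.
by rewrite ler_wpM2r ?spectral_norm_ge0 ?spectral_norm_tr_le.
Qed.

Lemma norm2_par_A_le d m (theta : 'rV[R]_(nparams d m)) :
  norm2 (par_A theta) <= norm2 theta.
Proof. by rewrite norm2_vec_mx norm2_lsubmx_le. Qed.

Lemma norm2_par_W1_le d m (theta : 'rV[R]_(nparams d m)) :
  norm2 (par_W1 theta) <= norm2 theta.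
Proof.
rewrite norm2_vec_mx; apply: le_trans (norm2_lsubmx_le _) _.
by do 2?[apply: le_trans (norm2_rsubmx_le _) _].
Qed.

Lemma norm2_par_W2_le d m (theta : 'rV[R]_(nparams d m)) :
  norm2 (par_W2 theta) <= norm2 theta.
Proof.
rewrite norm2_vec_mx; apply: le_trans (norm2_lsubmx_le _) _.
by do 4?[apply: le_trans (norm2_rsubmx_le _) _].
Qed.

(** Each Jacobian contributes [c1] times the norm of [A], and the Hessian contributes the factors in
    [W1], [W2] and [c2]. Only [A] is estimated by [theta]: the other weights stay explicit, since
    estimating them too would give degree 5. *)
Lemma mix_typical_le n d m (sigma : R -> R) (c1 c2 : R)
    (theta : 'rV[R]_(nparams d m)) (X : 'M[R]_(n, d)) (i j : 'I_n) (l : 'I_d) :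
  (forall t, derivable sigma t 1) ->
  (forall t, derivable (sigma^`())%classic t 1) ->
  (forall t, `|(sigma^`())%classic t| <= c1) ->
  (forall t, `|(sigma^`(2))%classic t| <= c2) -> i != j ->
  mix (typical_aggregate sigma theta) i j l X <=
    c1 ^+ 2 * c2 * spectral_norm (par_W1 theta) ^+ 2 *
    spectral_norm (par_W2 theta) * norm2 theta ^+ 2.
Proof.
move=> ds d2s sc1 sc2 ij.
have c1_ge0 : 0 <= c1 by apply: le_trans (sc1 0).
have c2_ge0 : 0 <= c2 by apply: le_trans (sc2 0).
have Jle x :
    spectral_norm (Jmx (typical_local sigma theta) x) <= c1 * norm2 theta.
  rewrite Jmx_dense_local //; apply: le_trans (spectral_normM _ _) _.
  apply: ler_pM; rewrite ?spectral_norm_ge0 //.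
    by apply: spectral_norm_diag_le => // k; rewrite mxE.
  exact: le_trans (spectral_norm_le_norm2 _) (norm2_par_A_le _).
have Hle z : spectral_norm (hessian (output (typical_pool sigma theta) l) z) <=
    spectral_norm (par_W1 theta) * (spectral_norm (par_W2 theta) * c2) *
    spectral_norm (par_W1 theta).
  rewrite hessian_mlp_pool //; apply: le_trans (spectral_normM _ _) _.
  rewrite ler_wpM2r ?spectral_norm_ge0 //.
  apply: le_trans (spectral_normM _ _) _.
  apply: ler_pM; rewrite ?spectral_norm_ge0 ?spectral_norm_tr_le //.
  apply: spectral_norm_diag_le => [|k].
    by rewrite mulr_ge0 ?spectral_norm_ge0.
  (* A diagonal entry is [W2 l k] times a value of [sigma''], and an entry of [W2] is at most its
     spectral norm. *)
  by rewrite mxE normrM ler_pM ?ler_entry_spectral_norm.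
apply: le_trans (mix_aggregate_le X ij _ _ _) _.
- by move=> x; have [] := is_diff_dense_local (par_A theta) (par_b theta) x ds.
- by move=> z; exact: differentiable_output_mlp_pool.
- move=> v z; rewrite derive_output_mlp_pool //.
  exact: differentiable_output_mlp_pool.
apply: (@le_trans _ _ (c1 * norm2 theta *
    (spectral_norm (par_W1 theta) * (spectral_norm (par_W2 theta) * c2) *
     spectral_norm (par_W1 theta)) * (c1 * norm2 theta))).
  by rewrite !ler_pM ?mulr_ge0 ?spectral_norm_ge0.
by rewrite le_eqVlt; apply/orP; left; apply/eqP; ring.
Qed.

(** Neighborhoods refer to the topology of matrices, not to [norm2]; the link is that the sum of
    squared coordinates is continuous and vanishes at 0. *)
Lemma near_norm2_le1 k : \forall v \near (0 : 'rV[R]_k), norm2 v <= 1.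
Proof.
pose f : 'rV[R]_k -> R :=
  \sum_(j < k) (fun v : 'rV[R]_k => v ord0 j) * (fun v => v ord0 j).
have f0 : f 0 = 0.
  by rewrite /f fct_sumE big1 // => j _; rewrite /GRing.mul /= mxE mulr0.
have : {for 0, continuous f}.
  apply: (@differentiable_continuous R); apply: differentiable_sum => j.
  by apply: differentiableM; exact: differentiable_coord.
rewrite /prop_for /continuous_at f0 => /cvgr_le /(_ 1 ltr01).
apply: filterS => v fv.
rewrite -(ler_pXn2r (ltn0Sn 1)) ?nnegrE ?norm2_ge0 // expr1n norm2_sqr big_ord1.
by move: fv; rewrite /f fct_sumE.
Qed.

End MixBounds.

(** * The general inequality and the two quadratic bounds in [theta] *)

Unset Implicit Arguments.
Set Strict Implicit.

Theorem proposition3p2 (R : realType) (n d m : nat)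
    (n_gt0 : (0 < n)%N) (d_gt0 : (0 < d)%N) (m_gt0 : (0 < m)%N) :
  (forall (phi : 'rV[R]_d -> 'rV[R]_m) (rho : 'rV[R]_m -> 'rV[R]_d),
     (forall x, differentiable phi x) ->
     C2 rho ->
     C2 (aggregate phi rho : 'M[R]_(n, d) -> 'rV[R]_d) ->
     forall (X : 'M[R]_(n, d)) (i j : 'I_n) (l : 'I_d), i != j ->
       mix (aggregate phi rho) i j l X <=
         spectral_norm (Jmx phi (row i X)) *
         spectral_norm (hessian (output rho l) (pooled phi X)) *
         spectral_norm (Jmx phi (row j X)))
  /\
  (forall (sigma : R -> R) (c1 c2 : R),
     (forall t, derivable sigma t 1) ->
     (forall t, derivable (sigma^`())%classic t 1) ->
     (forall t, `|(sigma^`())%classic t| <= c1) ->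
     (forall t, `|(sigma^`(2))%classic t| <= c2) ->
     (forall (X : 'M[R]_(n, d)) (i j : 'I_n) (l : 'I_d), i != j ->
        (fun theta => mix (typical_aggregate sigma theta) i j l X)
          =O_ (0 : 'rV[R]_(nparams d m)) (fun theta => norm2 theta ^+ 2))
     /\
     (forall B : R, exists C : R,
        forall (theta : 'rV[R]_(nparams d m)),
          spectral_norm (par_W1 theta) <= B ->
          spectral_norm (par_W2 theta) <= B ->
          forall (X : 'M[R]_(n, d)) (i j : 'I_n) (l : 'I_d), i != j ->
            mix (typical_aggregate sigma theta) i j l X <=
              C * norm2 theta ^+ 2)).
Proof.
split=> [phi rho dphi [[drho _] d2rho] _ X i j l ij|].
  have drho_l z : differentiable (output rho l) z.
    exact: differentiable_comp (drho z) (differentiable_coord _ _ _).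
  apply: mix_aggregate_le => // v z.
  (* Taking an output is linear, so it commutes with ['D_v], and the regularity of ['D_v rho] passes
     to its outputs. *)
  have -> : 'D_v (output rho l) = output ('D_v rho) l.
    apply/funext => y; rewrite deriveE // /output deriveE //.
    exact: (is_diffE v (is_diff_output l (differentiableP (drho y)))).
  exact: differentiable_comp ((d2rho v).1 z) (differentiable_coord _ _ _).
move=> sigma c1 c2 ds d2s sc1 sc2.
have c1_ge0 : 0 <= c1 by apply: le_trans (sc1 0).
have c2_ge0 : 0 <= c2 by apply: le_trans (sc2 0).
(* The factor [B ^+ 2] accounts for the two occurrences of [W1] in the Hessian, the last [B] for
   [W2]. *)
have bounded (B : R) theta : spectral_norm (par_W1 theta) <= B ->
    spectral_norm (par_W2 theta) <= B ->
    forall (X : 'M[R]_(n, d)) (i j : 'I_n) (l : 'I_d), i != j ->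
      mix (typical_aggregate sigma theta) i j l X <=
        c1 ^+ 2 * c2 * B ^+ 2 * B * norm2 (theta : 'rV[R]_(nparams d m)) ^+ 2.
  move=> W1B W2B X i j l ij.
  apply: le_trans (mix_typical_le _ X l ds d2s sc1 sc2 ij) _.
  rewrite ler_wpM2r ?sqr_ge0 // ler_pM ?spectral_norm_ge0 //.
    by rewrite !mulr_ge0 ?sqr_ge0 ?spectral_norm_ge0.
  rewrite ler_wpM2l ?mulr_ge0 ?sqr_ge0 // lerXn2r ?nnegrE ?spectral_norm_ge0 //.
  (* The sign of [B], needed to compare squares, follows from its being above a norm. *)
  exact: le_trans (spectral_norm_ge0 _) W1B.
split=> [X i j l ij|B]; last first.
  by exists (c1 ^+ 2 * c2 * B ^+ 2 * B) => theta; exact: bounded.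
(* The added 1 makes the constant positive even if [c1] or [c2] is 0. *)
apply/eqO_exP; exists (c1 ^+ 2 * c2 + 1).
  by rewrite ltr_wpDl // mulr_ge0 ?sqr_ge0.
(* Near 0 the whole of [theta] has norm at most 1, hence so do [W1] and [W2], and [bounded] applies
   with [B = 1]. *)
have := @near_norm2_le1 R (nparams d m); apply: filterS => theta theta1.
rewrite ger0_norm; last exact: spectral_norm_ge0.
rewrite ger0_norm ?sqr_ge0 //.
apply: le_trans (bounded 1 theta _ _ X i j l ij) _.
- apply: le_trans (spectral_norm_le_norm2 _) _.
  exact: le_trans (norm2_par_W1_le _) theta1.
- apply: le_trans (spectral_norm_le_norm2 _) _.
  exact: le_trans (norm2_par_W2_le _) theta1.
by rewrite ler_wpM2r ?sqr_ge0 // expr1n !mulr1 lerDl.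
Qed.
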